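(* Let $m>1$ be an integer such that $3 \nmid m$ and $2 \,\|\, m$ (that is, $m \equiv 2 \pmod 4$). Then the elliptic curve over $\mathbf{Q}$ given by \[ E'_m \colon y^2 = x^3 + x - m^6 \] has rank at least $2$.
   Context: The rank of an elliptic curve $E/\mathbf{Q}$ is the integer $r\ge 0$ such that $E(\mathbf{Q}) \simeq \mathbf{Z}^r \oplus T$ with $T$ a finite abelian group (Mordell-Weil theorem). *)

(* Defs.v *)
From HB Require Import structures.
From mathcomp Require Import all_boot all_order all_algebra.
From mathcomp Require Import ring.

Set Implicit Arguments.
Unset Strict Implicit.
Unset Printing Implicit Defensive.

Import Order.TTheory GRing.Theory Num.Theory.
Local Open Scope ring_scope.

(* Elliptic curves y^2 = x^3 + a x + b. Nonvanishing of the discriminant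
   excludes characteristic 2, where such an equation is always singular. *)
Record ecurve (K : fieldType) := ECurve {
  ec_a : K;
  ec_b : K;
  ec_disc : - 16%:R * (4%:R * ec_a ^+ 3 + 27%:R * ec_b ^+ 2) != 0
}.

Section Points.
Variables (K : fieldType) (E : ecurve K).

(* None is the point at infinity. *)
Definition on_curve (p : option (K * K)) : bool :=
  if p is Some (x, y) then y ^+ 2 == x ^+ 3 + ec_a E * x + ec_b E else true.

Record ec_point := ECPoint { ec_val :> option (K * K); _ : on_curve ec_val }.

HB.instance Definition _ := [isSub for ec_val].
HB.instance Definition _ := [Choice of ec_point by <:].

(* Slope of the chord, or of the tangent when the points coincide. *)
Definition ec_slope (x1 y1 x2 y2 : K) : K :=
  if x1 == x2 then (3%:R * x1 ^+ 2 + ec_a E) / (2%:R * y1)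
  else (y2 - y1) / (x2 - x1).

Definition ec_opp_val (p : option (K * K)) : option (K * K) :=
  if p is Some (x, y) then Some (x, - y) else None.

Definition ec_add_val (p q : option (K * K)) : option (K * K) :=
  match p, q with
  | None, _ => q
  | _, None => p
  | Some (x1, y1), Some (x2, y2) =>
      if (x1 == x2) && (y1 == - y2) then None else
      let l := ec_slope x1 y1 x2 y2 in
      let x3 := l ^+ 2 - x1 - x2 in
      Some (x3, l * (x1 - x3) - y1)
  end.

Let a := ec_a E.
Let b := ec_b E.

Lemma ec_two_neq0 : 2%:R != 0 :> K.
Proof.
apply: contra_neq (ec_disc E) => h2.
have -> : 16%:R = 2%:R * 8%:R :> K by rewrite -natrM.
by rewrite h2 mul0r oppr0 mul0r.
Qed.

Lemma ec_nopp_sym (x1 y1 x2 y2 : K) :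
  (x1 == x2) && (y1 == - y2) = (x2 == x1) && (y2 == - y1).
Proof. by rewrite eq_sym -eqr_oppLR [- y1 == _]eq_sym. Qed.

Definition is_slope (l x1 y1 x2 y2 : K) :=
  l * (x1 - x2) = y1 - y2 /\
  l * (y1 + y2) = x1 ^+ 2 + x1 * x2 + x2 ^+ 2 + a.

Lemma ec_slopeP x1 y1 x2 y2 :
  on_curve (Some (x1, y1)) -> on_curve (Some (x2, y2)) ->
  ~~ ((x1 == x2) && (y1 == - y2)) ->
  is_slope (ec_slope x1 y1 x2 y2) x1 y1 x2 y2.
Proof.
move=> /eqP h1 /eqP h2; rewrite /is_slope /ec_slope; rewrite -/a -/b in h1 h2 *.
case: (eqVneq x1 x2) => [e12|n12] /= nopp.
  subst x2; have /eqP : (y1 - y2) * (y1 + y2) = 0.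
    by rewrite -subr_sqr h1 h2 subrr.
  rewrite mulf_eq0 subr_eq0 (addr_eq0 y1) (negbTE nopp) orbF => /eqP e.
  subst y2; have y0 : y1 != 0.
    by apply: contra nopp => /eqP->; rewrite oppr0.
  have t0 := ec_two_neq0; split; first by rewrite !subrr mulr0.
  by field; rewrite y0.
have d : x2 - x1 != 0 by rewrite subr_eq0 eq_sym.
split; first by field.
apply: (mulfI d).
rewrite mulrA [_ * (_ / _)]mulrC divfK //.
transitivity (y2 ^+ 2 - y1 ^+ 2); first by ring.
by rewrite h1 h2; ring.
Qed.

Lemma is_slope_uniq l l' x1 y1 x2 y2 :
  ~~ ((x1 == x2) && (y1 == - y2)) ->
  is_slope l x1 y1 x2 y2 -> is_slope l' x1 y1 x2 y2 -> l = l'.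
Proof.
move=> nopp [h1 h2] [h3 h4]; case: (eqVneq x1 x2) nopp => /= [_|n] nopp.
  have d : y1 + y2 != 0 by rewrite addr_eq0.
  by apply: (mulIf d); rewrite h2 h4.
have d : x1 - x2 != 0 by rewrite subr_eq0.
by apply: (mulIf d); rewrite h1 h3.
Qed.

Lemma ec_add_valE l x1 y1 x2 y2 :
  on_curve (Some (x1, y1)) -> on_curve (Some (x2, y2)) ->
  ~~ ((x1 == x2) && (y1 == - y2)) -> is_slope l x1 y1 x2 y2 ->
  ec_add_val (Some (x1, y1)) (Some (x2, y2)) =
    Some (l ^+ 2 - x1 - x2, l * (x1 - (l ^+ 2 - x1 - x2)) - y1).
Proof.
move=> h1 h2 nopp hl; rewrite /ec_add_val (negbTE nopp).
by rewrite (is_slope_uniq nopp (ec_slopeP h1 h2 nopp) hl).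
Qed.

Lemma is_slopeC l x1 y1 x2 y2 :
  is_slope l x1 y1 x2 y2 -> is_slope l x2 y2 x1 y1.
Proof.
move=> [h1 h2]; split; first by rewrite -opprB mulrN h1 opprB.
by rewrite addrC h2; ring.
Qed.

Lemma ec_add_on p q : on_curve p -> on_curve q -> on_curve (ec_add_val p q).
Proof.
case: p q => [[x1 y1]|] [[x2 y2]|] // h1 h2.
case: (boolP ((x1 == x2) && (y1 == - y2))) => [h|nopp].
  by rewrite /ec_add_val h.
have hl := ec_slopeP h1 h2 nopp; rewrite (ec_add_valE h1 h2 nopp hl).
move: (ec_slope _ _ _ _) hl => l [hl1 hl2] /=.
move: h1 => /eqP h1; rewrite -/a -/b in h1 *; apply/eqP.
have hy2 : y2 = y1 - l * (x1 - x2) by rewrite hl1; ring.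
have ha : a = l * (y1 + y2) - (x1 ^+ 2 + x1 * x2 + x2 ^+ 2).
  by rewrite hl2; ring.
have hb : b = y1 ^+ 2 - x1 ^+ 3 - a * x1 by rewrite h1; ring.
by rewrite hb ha hy2; ring.
Qed.

Lemma ec_opp_on p : on_curve p -> on_curve (ec_opp_val p).
Proof. by case: p => [[x y]|] //=; rewrite sqrrN. Qed.

Lemma ec_add_valC p q :
  on_curve p -> on_curve q -> ec_add_val p q = ec_add_val q p.
Proof.
case: p q => [[x1 y1]|] [[x2 y2]|] // h1 h2.
case: (boolP ((x1 == x2) && (y1 == - y2))) => [h|nopp].
  by rewrite /ec_add_val h ec_nopp_sym h.
have nopp' : ~~ ((x2 == x1) && (y2 == - y1)).
  by rewrite ec_nopp_sym.
have hl := ec_slopeP h1 h2 nopp.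
rewrite (ec_add_valE h1 h2 nopp hl) (ec_add_valE h2 h1 nopp' (is_slopeC hl)).
move: (ec_slope _ _ _ _) hl => l [hl1 _].
congr (Some (_, _)); first by ring.
have -> : y1 = y2 + l * (x1 - x2) by rewrite hl1; ring.
by ring.
Qed.

Lemma ec_opp_add p q :
  on_curve p -> on_curve q ->
  ec_opp_val (ec_add_val p q) = ec_add_val (ec_opp_val p) (ec_opp_val q).
Proof.
case: p q => [[x1 y1]|] [[x2 y2]|] // h1 h2.
case: (boolP ((x1 == x2) && (y1 == - y2))) => [h|nopp].
  by case/andP: h => /eqP-> /eqP->; rewrite /= !eqxx.
have nopp' : ~~ ((x1 == x2) && (- y1 == - - y2)) by rewrite eqr_opp.
have hl := ec_slopeP h1 h2 nopp.
have [hl1 hl2] := hl.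
rewrite (ec_add_valE h1 h2 nopp hl).
have hl' : is_slope (- ec_slope x1 y1 x2 y2) x1 (- y1) x2 (- y2).
  split; first by rewrite mulNr hl1; ring.
  by rewrite -hl2; ring.
rewrite (ec_add_valE (ec_opp_on h1) (ec_opp_on h2) nopp' hl').
by move: (ec_slope _ _ _ _) => l /=; congr (Some (_, _)); ring.
Qed.

Lemma ec_add_valKl q p :
  on_curve q -> on_curve p -> ec_add_val (ec_opp_val q) (ec_add_val q p) = p.
Proof.
case: q p => [[x2 y2]|] [[x1 y1]|] // h2 h1; last first.
  by rewrite /= eqxx eqxx.
case: (boolP ((x2 == x1) && (y2 == - y1))) => [h|nopp].
  by rewrite {2}/ec_add_val h; case/andP: h => /eqP-> /eqP->; rewrite /= opprK.
have hl := ec_slopeP h2 h1 nopp.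
rewrite (ec_add_valE h2 h1 nopp hl).
have h3 := ec_add_on h2 h1; rewrite (ec_add_valE h2 h1 nopp hl) in h3.
move: (ec_slope _ _ _ _) hl h3 => l [hl1 hl2].
set x3 := l ^+ 2 - x2 - x1; set y3 := _ - y2 => h3.
have hy1 : y1 = y2 - l * (x2 - x1) by rewrite hl1; ring.
have ha : a = l * (y2 + y1) - (x2 ^+ 2 + x2 * x1 + x1 ^+ 2).
  by rewrite hl2; ring.
have nopp' : ~~ ((x2 == x3) && (- y2 == - y3)).
  apply/andP => -[/eqP ex /eqP ey].
  have y0 : y2 = 0.
    have /eqP : 2%:R * y2 = 0.
      have -> : 2%:R * y2 = y2 + y2 by ring.
      by rewrite {2}(oppr_inj ey) /y3 -ex; ring.
    by rewrite mulf_eq0 (negbTE ec_two_neq0) => /eqP.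
  have hx1 : x1 = l ^+ 2 - 2%:R * x2.
    have -> : x1 = l ^+ 2 - x2 - x3 by rewrite /x3; ring.
    by rewrite -ex; ring.
  have ha3 : a = - 3%:R * x2 ^+ 2 by rewrite ha hy1 hx1 y0; ring.
  have hb : b = 2%:R * x2 ^+ 3.
    have -> : b = y2 ^+ 2 - x2 ^+ 3 - a * x2.
      by move: h2 => /eqP->; rewrite -/a -/b; ring.
    by rewrite y0 ha3; ring.
  have := ec_disc E; rewrite -/a -/b ha3 hb => /negP; apply.
  by apply/eqP; ring.
have hm : is_slope (- l) x2 (- y2) x3 y3.
  by split; [rewrite /y3; ring | rewrite ha /y3 hy1 /x3; ring].
rewrite (ec_add_valE (ec_opp_on h2) h3 nopp' hm).
by congr (Some (_, _)); rewrite ?hy1 /x3; ring.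
Qed.

Lemma ec_opp_valK p : ec_opp_val (ec_opp_val p) = p.
Proof. by case: p => [[x y]|] //=; rewrite opprK. Qed.

Lemma ec_add_oppr p : ec_add_val (ec_opp_val p) p = None.
Proof. by case: p => [[x y]|] //=; rewrite !eqxx. Qed.

Lemma ec_add_eq0 p q : ec_add_val p q = None -> p = ec_opp_val q.
Proof.
case: p q => [[x1 y1]|] [[x2 y2]|] //=.
by case: ifP => // /andP[/eqP-> /eqP->].
Qed.

Lemma ec_slope_key l1 l2 m x1 x2 x3 y2 (y1 := y2 + l1 * (x1 - x2))
    (y3 := y2 + l2 * (x3 - x2)) (x12 := l1 ^+ 2 - x2 - x1)
    (y12 := l1 * (x2 - x12) - y2) :
  a = l1 * (y2 + y1) - (x2 ^+ 2 + x2 * x1 + x1 ^+ 2) ->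
  l1 * (y2 + y1) - (x2 ^+ 2 + x2 * x1 + x1 ^+ 2)
    - (l2 * (y2 + y3) - (x2 ^+ 2 + x2 * x3 + x3 ^+ 2)) = 0 ->
  ~~ ((x12 == x3) && (y12 == - y3)) -> is_slope m x12 y12 x3 y3 ->
  m * (l1 - l2) = l1 * l2 - (x12 + x3 + x2).
Proof.
move=> ha; set rel := (X in X = 0 -> _) => h0 nopp [i j].
apply/eqP; rewrite -subr_eq0; apply/eqP.
case: (eqVneq x12 x3) nopp => /= [e|ne] nopp.
  have d : y12 + y3 != 0 by rewrite addr_eq0.
  apply: (mulIf d); rewrite mul0r.
  transitivity ((l1 - l2) * (m * (y12 + y3))
      - (y12 + y3) * (l1 * l2 - (x12 + x3 + x2))); first by ring.
  rewrite j ha; transitivity (l1 * rel); last by rewrite h0 mulr0.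
  by rewrite /rel /y12 /y1 /y3 /x12; ring.
have d : x12 - x3 != 0 by rewrite subr_eq0.
apply: (mulIf d); rewrite mul0r.
transitivity ((l1 - l2) * (m * (x12 - x3))
      - (x12 - x3) * (l1 * l2 - (x12 + x3 + x2))); first by ring.
rewrite i; transitivity (- rel); last by rewrite h0 oppr0.
by rewrite /rel /y12 /y1 /y3 /x12; ring.
Qed.

Lemma ec_add_valA p q r : on_curve p -> on_curve q -> on_curve r ->
  ec_add_val p (ec_add_val q r) = ec_add_val (ec_add_val p q) r.
Proof.
move=> hp hq hr.
have [hpq hqr] := (ec_add_on hp hq, ec_add_on hq hr).
case epq: (ec_add_val p q) => [[x12 y12]|]; last first.
  by rewrite (ec_add_eq0 epq) ec_add_valKl.
case eqr: (ec_add_val q r) => [[x23 y23]|]; last first.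
  rewrite ec_add_valC // -epq (ec_add_valC _ hr) //.
  have -> : r = ec_opp_val q by rewrite (ec_add_eq0 eqr) ec_opp_valK.
  by rewrite (ec_add_valC hp hq) ec_add_valKl.
rewrite -eqr -epq.
case eL: (ec_add_val (ec_add_val p q) r) => [[xl yl]|]; last first.
  have -> : r = ec_opp_val (ec_add_val p q).
    by rewrite (ec_add_eq0 eL) ec_opp_valK.
  rewrite ec_opp_add // (ec_add_valC (ec_opp_on hp)) ?ec_opp_on //.
  rewrite -{1}[q]ec_opp_valK ec_add_valKl ?ec_opp_on //.
  by rewrite ec_add_valC ?ec_opp_on // ec_add_oppr.
case eR: (ec_add_val p (ec_add_val q r)) => [[xr yr]|]; last first.
  move: eL; rewrite (ec_add_eq0 eR) ec_opp_add //.
  rewrite (ec_add_valC (ec_opp_on hq)) ?ec_opp_on //.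
  rewrite (ec_add_valC (ec_add_on (ec_opp_on hr) (ec_opp_on hq))) //.
  rewrite (ec_add_valC (ec_opp_on hr)) ?ec_opp_on //.
  rewrite -{1}[q]ec_opp_valK ec_add_valKl ?ec_opp_on //.
  by rewrite ec_add_oppr.
rewrite -eL -eR.
case: (eqVneq p r) => [epr|npr].
  by rewrite -epr (ec_add_valC hp) ?ec_add_on // (ec_add_valC hq).
case: p q r hp hq hr hpq hqr epq eqr eL eR npr =>
  [[x1 y1]|] [[x2 y2]|] [[x3 y3]|] // hp hq hr hpq hqr epq eqr eL eR npr.
have n12 : ~~ ((x2 == x1) && (y2 == - y1)).
  by apply/negP => h; move: epq; rewrite ec_add_valC // /ec_add_val h.
have n23 : ~~ ((x2 == x3) && (y2 == - y3)).
  by apply/negP => h; move: eqr; rewrite /ec_add_val h.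
have s12 := ec_slopeP hq hp n12; have s23 := ec_slopeP hq hr n23.
rewrite (ec_add_valC hp hq) in epq hpq eL *.
rewrite (ec_add_valE hq hp n12 s12) in epq hpq eL *.
rewrite (ec_add_valE hq hr n23 s23) in eqr hqr eR *.
move: (ec_slope x2 y2 x1 y1) (ec_slope x2 y2 x3 y3) s12 s23 epq eqr hpq hqr eL eR.
move=> l1 l2 s12 s23 epq eqr hpq hqr eL eR.
move: epq eqr => -[ex12 ey12] [ex23 ey23].
rewrite ey12 ex12 in hpq eL *; rewrite ey23 ex23 in hqr eR *.
have nL : ~~ ((x12 == x3) && (y12 == - y3)).
  by apply/negP => h; move: eL; rewrite /ec_add_val h.
have nR : ~~ ((x1 == x23) && (y1 == - y23)).
  by apply/negP => h; move: eR; rewrite /ec_add_val h.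
have sL := ec_slopeP hpq hr nL; have sR := ec_slopeP hp hqr nR.
rewrite (ec_add_valE hpq hr nL sL) (ec_add_valE hp hqr nR sR).
move: (ec_slope x12 _ _ _) (ec_slope x1 _ _ _) sL sR => m1 m2 [i1 j1] [i2 j2].
have [g1 k1] := s12; have [g2 k2] := s23.
have hy1 : y1 = y2 + l1 * (x1 - x2).
  by rewrite -(opprB x2 x1) mulrN g1; ring.
have hy3 : y3 = y2 + l2 * (x3 - x2).
  by rewrite -(opprB x2 x3) mulrN g2; ring.
have ha1 : a = l1 * (y2 + y1) - (x2 ^+ 2 + x2 * x1 + x1 ^+ 2).
  by rewrite k1; ring.
have ha2 : a = l2 * (y2 + y3) - (x2 ^+ 2 + x2 * x3 + x3 ^+ 2).
  by rewrite k2; ring.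
have rel : l1 * (y2 + y1) - (x2 ^+ 2 + x2 * x1 + x1 ^+ 2)
         - (l2 * (y2 + y3) - (x2 ^+ 2 + x2 * x3 + x3 ^+ 2)) = 0.
  by rewrite -ha1 -ha2 subrr.
have rel' : l2 * (y2 + y3) - (x2 ^+ 2 + x2 * x3 + x3 ^+ 2)
         - (l1 * (y2 + y1) - (x2 ^+ 2 + x2 * x1 + x1 ^+ 2)) = 0.
  by rewrite -ha1 -ha2 subrr.
have nR' : ~~ ((x23 == x1) && (y23 == - y1)).
  by rewrite ec_nopp_sym.
have sR : is_slope m2 x23 y23 x1 y1 by apply: is_slopeC; split.
have sL : is_slope m1 x12 y12 x3 y3 by split.
rewrite ex12 in ey12; rewrite ex23 in ey23.
rewrite hy1 hy3 in rel rel' ha1 ha2 nL nR' sL sR npr *; subst x12 x23 y12 y23.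
have cL := ec_slope_key ha1 rel nL sL.
have cR := ec_slope_key ha2 rel' nR' sR.
case: (eqVneq l1 l2) => [e|ne].
  subst l2.
  have /eqP : (x1 - x3) * (l1 ^+ 2 - x2 - x3 - x1) = 0.
    by rewrite -rel; ring.
  rewrite mulf_eq0 !subr_eq0 => /orP[/eqP e|/eqP e].
    by move: npr; rewrite e eqxx.
  case/negP: nR'; rewrite e eqxx /=; apply/eqP; ring.
have d : l1 - l2 != 0 by rewrite subr_eq0.
have em : m2 = m1 + (l1 - l2).
  apply: (mulIf d).
  transitivity (- (m2 * (l2 - l1))); first by ring.
  rewrite cR mulrDl cL; ring.
have ex : m2 ^+ 2 - x1 - (l2 ^+ 2 - x2 - x3) =
          m1 ^+ 2 - (l1 ^+ 2 - x2 - x1) - x3.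
  rewrite em; apply/eqP; rewrite -subr_eq0; apply/eqP.
  transitivity (2%:R * (m1 * (l1 - l2)) + (l1 - l2) ^+ 2 - x1
     - (l2 ^+ 2 - x2 - x3) + (l1 ^+ 2 - x2 - x1) + x3); first by ring.
  by rewrite cL; ring.
rewrite ex; congr (Some (_, _)).
rewrite em; apply/eqP; rewrite -subr_eq0; apply/eqP; apply: (mulIf d).
set x12 := l1 ^+ 2 - x2 - x1.
transitivity (- (m1 * (l1 - l2)) ^+ 2 - (m1 * (l1 - l2)) * (x12 - x1)
   + (l1 - l2) ^+ 2 * (x1 + x12 + x3)
   - (l1 - l2) * (y2 + l1 * (x1 - x2) + y2 - l1 * (x2 - x12))); first by ring.
by rewrite cL mul0r -oppr0 -rel /x12; ring.
by rewrite [RHS]ec_add_valC.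
Qed.

Definition ec_opp (P : ec_point) : ec_point :=
  let: ECPoint p h := P in ECPoint (ec_opp_on h).

Definition ec_add (P Q : ec_point) : ec_point :=
  let: ECPoint p hp := P in let: ECPoint q hq := Q in
  ECPoint (ec_add_on hp hq).

Definition ec_zero : ec_point := @ECPoint None isT.

Lemma ec_addA : associative ec_add.
Proof.
by move=> [p hp] [q hq] [r hr]; apply: val_inj; apply: ec_add_valA.
Qed.

Lemma ec_addC : commutative ec_add.
Proof. by move=> [p hp] [q hq]; apply: val_inj; apply: ec_add_valC. Qed.

Lemma ec_add0 : left_id ec_zero ec_add.
Proof. by move=> [p hp]; apply: val_inj. Qed.

Lemma ec_addN : left_inverse ec_zero ec_opp ec_add.
Proof. by move=> [p hp]; apply: val_inj; apply: ec_add_oppr. Qed.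

HB.instance Definition _ :=
  GRing.isZmodule.Build ec_point ec_addA ec_addC ec_add0 ec_addN.

End Points.

(* The rank as a relation: a finitely generated G has exactly one such r, and
   by the Mordell-Weil theorem this covers E(Q) for every E over Q. *)
Definition has_rank (G : zmodType) (r : nat) : Prop :=
  exists (T : finZmodType) (f : {additive G -> 'rV[int]_r * T}), bijective f.

Lemma curve_E'_disc (m : int) :
  - 16%:R * (4%:R * (1 : rat) ^+ 3 + 27%:R * (- m%:~R ^+ 6) ^+ 2) != 0 :> rat.
Proof.
rewrite mulf_neq0 // expr1n mulr1 sqrrN lt0r_neq0 //.
by rewrite ltr_pwDl // mulr_ge0 // sqr_ge0.
Qed.

Definition curve_E' (m : int) : ecurve rat := ECurve (curve_E'_disc m).

Lemma on_curve_E' (m : int) (x y : rat) :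
  on_curve (curve_E' m) (Some (x, y)) = (y ^+ 2 == x ^+ 3 + x - m%:~R ^+ 6).
Proof. by rewrite /= mul1r. Qed.

(* Main.v *)
Require Import Defs.
From mathcomp Require Import all_boot all_order all_algebra.
From mathcomp Require Import ring lra zify.

(** The points [P = (m^2, m)] and [R = (m^6, m^9)] lie on the curve, and
    [x(P + R) = (m^4 + 1) / m^2]. Writing [x(S) = u / v] in lowest terms, the
    duplication formula for [2 S = P], [2 S = R] or [2 S = P + R] fails
    2-adically when [m] is twice an odd number. There is no rational 2-torsion
    because an integral root of [x^3 + x = (m^2)^3] would lie strictly between
    [m^2 - 1] and [m^2]. So the torsion subgroup is 2-divisible, and [P], [R]
    are independent in [E(Q) / 2 E(Q) = (Z / 2)^r]. *)

Set Implicit Arguments.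
Unset Strict Implicit.

Import Order.TTheory GRing.Theory Num.Theory.
Local Open Scope ring_scope.

(** * Parity and powers of 2 in the integers *)

Definition oddz (z : int) : bool := odd `|z|%N.

Lemma oddzM (x y : int) : oddz (x * y) = oddz x && oddz y.
Proof. by rewrite /oddz abszM oddM. Qed.

Lemma oddzD (x y : int) : oddz (x + y) = oddz x (+) oddz y.
Proof. rewrite /oddz; lia. Qed.

Lemma oddzN (x : int) : oddz (- x) = oddz x.
Proof. by rewrite /oddz abszN. Qed.

Lemma oddzX (x : int) k : oddz (x ^+ k.+1) = oddz x.
Proof. by rewrite /oddz abszX oddX. Qed.

(** Applying [congr1 oddz] to an integer identity and rewriting with these rules reduces it to a
    Boolean identity in the parities of the variables. *)
Definition oddzE := (oddzM, oddzD, oddzN, oddzX).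

Lemma oddzP (z : int) : oddz z -> exists s, z = 2 * s + 1.
Proof. by rewrite /oddz => h; exists ((z - 1) %/ 2)%Z; lia. Qed.

Lemma oddz_dvd2 (z : int) : oddz z = ~~ (2 %| z)%Z.
Proof. by rewrite /oddz dvdzE dvdn2 negbK. Qed.

Lemma sqr_eq_exp2M (k : nat) (a b : int) :
  a ^+ 2 = 2 ^+ (k * 2) * b -> exists c, a = 2 ^+ k * c.
Proof.
move=> e; have : ((2 ^+ k) ^+ 2 %| a ^+ 2)%Z by rewrite e -exprM dvdz_mulr.
by rewrite dvdz_pexp2r // => /dvdzP [c ->]; exists c; rewrite mulrC.
Qed.

Lemma sqrB_even_coprime (u v : int) : coprime `|u| `|v| ->
  ~~ oddz (u ^+ 2 - v ^+ 2) -> oddz u /\ oddz v.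
Proof.
rewrite !oddzE /oddz => cuv; case hu: (odd `|u|%N); case hv: (odd `|v|%N) => //= _.
by move: (dvdn_gcd 2 `|u| `|v|); rewrite (eqP cuv) !dvdn2 hu hv.
Qed.

Lemma oddz_sqrD (u v : int) : oddz u -> oddz v ->
  exists2 w, oddz w & u ^+ 2 + v ^+ 2 = 2 * w.
Proof.
move=> /oddzP[s ->] /oddzP[t ->].
exists (2 * (s ^+ 2 + s + t ^+ 2 + t) + 1); last by ring.
by rewrite !oddzE.
Qed.

(** Odd squares are 1 modulo 8: (2s + 1)^2 = 4(s^2 + s) + 1, and s^2 + s is even. *)
Lemma oddz_sqrB (u v : int) : oddz u -> oddz v ->
  exists d, u ^+ 2 - v ^+ 2 = 8 * d.
Proof.
have tri (s : int) : exists t, s ^+ 2 + s = 2 * t.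
  have /dvdzP[t ->] : (2 %| s ^+ 2 + s)%Z.
    by apply/negPn; rewrite -oddz_dvd2 !oddzE addbb.
  by exists t; rewrite mulrC.
move=> /oddzP[s ->] /oddzP[t ->]; have [[a ha] [b hb]] := (tri s, tri t).
exists (a - b).
transitivity (4 * (s ^+ 2 + s) - 4 * (t ^+ 2 + t)); first by ring.
by rewrite ha hb; ring.
Qed.

(** * 2-adic obstructions to halving *)

Section Halving.
Variables (n u v : int).
Hypotheses (on : oddz n) (cuv : coprime `|u| `|v|).
Let m := 2 * n.
(** At x = u / v, [D] is v^2 (x^2 - 1) and [cubic] is v^4 (x^3 + x - m^6): the ingredients of the
    duplication formula, cleared of denominators. *)
Let D := u ^+ 2 - v ^+ 2.
Let cubic := v * (u ^+ 3 + u * v ^+ 2 - m ^+ 6 * v ^+ 3).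

(* The two sides have 2-adic valuations at least 6 and exactly 5. *)
Lemma no_half_P :
  D ^+ 2 + 8 * m ^+ 6 * u * v ^+ 3 = 4 * m ^+ 2 * cubic -> False.
Proof.
move=> e.
have [|ou ov] := @sqrB_even_coprime u v cuv.
  by have := congr1 oddz e; rewrite /D !oddzE; case: (oddz u); case: (oddz v).
have [d hd] := oddz_sqrB ou ov; have [w ow hw] := oddz_sqrD ou ov.
have /(congr1 oddz) : 2 * (d ^+ 2 + 8 * n ^+ 6 * u * v ^+ 3
     + 16 * n ^+ 8 * v ^+ 4) = n ^+ 2 * v * u * w.
  apply: (@mulfI _ 32) => //.
  have {e} : 64 * d ^+ 2 + 8 * m ^+ 6 * u * v ^+ 3 =
      4 * m ^+ 2 * v * (u * (2 * w) - m ^+ 6 * v ^+ 3).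
    by move: e; rewrite /D hd /cubic -hw => e; lra.
  by rewrite /m => e; lra.
by rewrite !oddzE on ou ov ow.
Qed.

(* The equation is [(D - 2 m^6 u v)^2 = 4 m^12 v^2 D]. Its form as a quadratic in
   [D] forces [D = 2^7 c] with [c] odd, and then the right-hand side has odd
   2-adic valuation. *)
Lemma no_half_R :
  D ^+ 2 + 8 * m ^+ 6 * u * v ^+ 3 = 4 * m ^+ 6 * cubic -> False.
Proof.
move=> e.
have [|ou ov] := @sqrB_even_coprime u v cuv.
  by have := congr1 oddz e; rewrite /D !oddzE; case: (oddz u); case: (oddz v).
have {}e : D ^+ 2 = 2 ^+ 8 * n ^+ 6 * u * v * D - 2 ^+ 14 * n ^+ 12 * v ^+ 4.
  by rewrite /D /cubic /m in e *; lra.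
(* Bootstrapping: each power of 2 found in [D] raises the one dividing the right-hand side, from 2^8
   to 2^12 and then 2^14. *)
have [a ha] : exists a, D = 2 ^+ 4 * a.
  apply: (@sqr_eq_exp2M 4 _ (n ^+ 6 * u * v * D - 2 ^+ 6 * n ^+ 12 * v ^+ 4)).
  by rewrite e; ring.
have [b hb] : exists b, D = 2 ^+ 6 * b.
  apply: (@sqr_eq_exp2M 6 _ (n ^+ 6 * u * v * a - 2 ^+ 2 * n ^+ 12 * v ^+ 4)).
  by rewrite e ha; ring.
have [c hc] : exists c, D = 2 ^+ 7 * c.
  apply: (@sqr_eq_exp2M 7 _ (n ^+ 6 * u * v * b - n ^+ 12 * v ^+ 4)).
  by rewrite e hb; ring.
have {}e : c ^+ 2 = 2 * n ^+ 6 * u * v * c - n ^+ 12 * v ^+ 4.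
  by apply: (@mulfI _ (2 ^+ 14)) => //; rewrite hc in e; lra.
have oc : oddz c by have := congr1 oddz e; rewrite !oddzE on ov.
(* Completing the square in [c] leaves n^12 v^2 (u^2 - v^2), where [D] reappears. *)
have e2 : (c - n ^+ 6 * u * v) ^+ 2 = n ^+ 12 * v ^+ 2 * (2 ^+ 7 * c).
  by rewrite -hc /D; lra.
have [f hf] : exists f, c - n ^+ 6 * u * v = 2 ^+ 3 * f.
  apply: (@sqr_eq_exp2M 3 _ (2 * n ^+ 12 * v ^+ 2 * c)).
  by rewrite e2; ring.
have /(congr1 oddz) : f ^+ 2 = 2 * (n ^+ 12 * v ^+ 2 * c).
  by apply: (@mulfI _ (2 ^+ 6)) => //; rewrite hf in e2; lra.
rewrite !oddzE /= => of_.
have [h hh] : exists h, f = 2 * h.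
  by have := of_; rewrite oddz_dvd2 => /negbFE/dvdzP[h ->]; exists h; rewrite mulrC.
have /(congr1 oddz) : 2 * h ^+ 2 = n ^+ 12 * v ^+ 2 * c.
  by apply: (@mulfI _ (2 ^+ 7)) => //; rewrite hf hh in e2; lra.
by rewrite !oddzE on ov oc.
Qed.

(** After division by 4 the two sides have 2-adic valuations at least 6 and exactly 1. Here [u] and
    [v] are odd because [cubic] is always even, which makes [D] even. *)
Lemma no_half_PR :
  m ^+ 2 * (D ^+ 2 + 8 * m ^+ 6 * u * v ^+ 3) = 4 * (m ^+ 4 + 1) * cubic -> False.
Proof.
move=> e.
have {}e : n ^+ 2 * (D ^+ 2 + 8 * m ^+ 6 * u * v ^+ 3) = (m ^+ 4 + 1) * cubic.
  by apply: (@mulfI _ 4) => //; rewrite {1}/m in e; lra.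
have [|ou ov] := @sqrB_even_coprime u v cuv.
  have := congr1 oddz e; rewrite /cubic /D /m !oddzE on /=.
  by case: (oddz u); case: (oddz v).
have [d hd] := oddz_sqrB ou ov; have [w ow hw] := oddz_sqrD ou ov.
have {}e : n ^+ 2 * (64 * d ^+ 2 + 8 * m ^+ 6 * u * v ^+ 3) =
      (m ^+ 4 + 1) * v * (u * (2 * w) - m ^+ 6 * v ^+ 3).
  by move: e; rewrite /D hd /cubic -hw => e; lra.
have /(congr1 oddz) : n ^+ 2 * (2 * (16 * d ^+ 2 + 2 * m ^+ 6 * u * v ^+ 3)) =
      (m ^+ 4 + 1) * v * (u * w - 32 * n ^+ 6 * v ^+ 3).
  by apply: (@mulfI _ 2) => //; rewrite /m in e *; lra.
by rewrite /m !oddzE on ou ov ow.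
Qed.

End Halving.

(** * Duplication formula and absence of rational 2-torsion *)

Lemma ec_val_add (K : fieldType) (E : ecurve K) (S T : ec_point E) :
  ec_val (S + T) = ec_add_val E S T.
Proof. by case: S T => [s hs] [t ht]. Qed.

(** The tangent slope gives x(2S) = ((x^2 - a)^2 - 8bx) / (4y^2), and the curve equation replaces
    y^2 by the cubic. An affine double forces y to be nonzero. *)
Lemma ec_val_double (E : ecurve rat) (S : ec_point E) (X Y : rat) :
  ec_val (S + S) = Some (X, Y) -> exists x : rat,
  (x ^+ 2 - ec_a E) ^+ 2 - 8 * ec_b E * x =
    4 * X * (x ^+ 3 + ec_a E * x + ec_b E).
Proof.
rewrite ec_val_add; case: S => [[[x y]|] //= /eqP hS].
rewrite eqxx /= /ec_slope eqxx; case: eqVneq => // ny [<- _]; exists x.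
rewrite -hS.
have y0 : y != 0 by apply: contra_neq ny => ->; rewrite oppr0.
have -> : ec_b E = y ^+ 2 - x ^+ 3 - ec_a E * x by rewrite hS; ring.
by field.
Qed.

Lemma ec_double_eq0 (E : ecurve rat) (S : ec_point E) :
  (forall x, x ^+ 3 + ec_a E * x + ec_b E != 0) -> S + S = 0 -> S = 0.
Proof.
move=> h /(congr1 (@ec_val _ _)); rewrite ec_val_add.
case: S => [[[x y]|] hS] //=; last by move=> _; apply: val_inj.
rewrite eqxx /=; case: eqP => // /eqP; rewrite eq_sym -subr_eq0 -opprD oppr_eq0.
rewrite -mulr2n mulrn_eq0 /= => /eqP y0; case/negP: (h x).
by move: hS; rewrite /= y0 expr0n /= eq_sym.
Qed.

Lemma cubic_bounds (u M : int) : 1 < M -> u ^+ 3 + u != M ^+ 3.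
Proof.
move=> M1; apply/eqP => e.
have [uM|uM] := lerP M u.
  have : M ^+ 3 <= u ^+ 3 by rewrite lerXn2r // nnegrE; lra.
  lra.
have [u0|u0] := ltrP u 0.
  have : u ^+ 3 <= 0 by rewrite exprn_odd_le0 //; lra.
  have : 0 < M ^+ 3 by rewrite exprn_gt0; lra.
  lra.
have {}uM : u <= M - 1 by move: uM; clear; lia.
have : u ^+ 3 <= (M - 1) ^+ 3 by rewrite lerXn2r // ?nnegrE; lra.
have -> : (M - 1) ^+ 3 = M ^+ 3 - 3 * (M * (M - 1)) - 1 by ring.
(* The term 3M(M - 1) is at least 3M, which outweighs the linear term [u]. *)
have : M <= M * (M - 1) by rewrite ler_peMr; move: M1; clear; lia.
lra.
Qed.

(** Rational root argument: [v] divides u^3 and is coprime to it, so v = 1, and [cubic_bounds]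
    applies with M = m^2. *)
Lemma cubic_coprime (u v m : int) : 1 < m -> 0 < v -> coprime `|u| `|v| ->
  u ^+ 3 + u * v ^+ 2 != m ^+ 6 * v ^+ 3.
Proof.
move=> m1 v0 cuv; apply/eqP => e.
have v1 : v = 1.
  have: (v %| u ^+ 3)%Z.
    apply/dvdzP; exists (m ^+ 6 * v ^+ 2 - u * v).
    by rewrite -[LHS](addrK (u * v ^+ 2)) e; ring.
  rewrite dvdzE abszX => hd.
  have := coprimeXr 3; rewrite coprime_sym in cuv => /(_ _ _ cuv).
  by rewrite /coprime (gcdn_idPl hd) => /eqP; move: v0; clear; lia.
have m2 : 1 < m ^+ 2 by rewrite exprn_egt1.
have /negP[] := cubic_bounds u m2.
by apply/eqP; rewrite -exprM -[RHS]mulr1 -(expr1n _ 3) -v1 -e v1; ring.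
Qed.

Lemma rat_coprimeP (x : rat) : exists u v : int,
  [/\ 0 < v, v%:~R != 0 :> rat, coprime `|u| `|v| & x = u%:~R / v%:~R].
Proof.
exists (numq x), (denq x).
by rewrite denq_gt0 intr_eq0 denq_eq0 coprime_num_den divq_num_den.
Qed.

Lemma cubic_E'_neq0 (m : int) : 1 < m -> forall x : rat,
  x ^+ 3 + x - m%:~R ^+ 6 != 0.
Proof.
move=> m1 x; apply/eqP; have [u [v [v0 nv cuv ->]]] := rat_coprimeP x => e.
have /negP[] := cubic_coprime m1 v0 cuv.
rewrite -(eqr_int rat) !(rmorphD, rmorphM, rmorphXn) /= -subr_eq0.
by apply/eqP; rewrite -[RHS](mulr0 (v%:~R ^+ 3)) -e; field.
Qed.

(** Multiplying the duplication formula by B v^4 makes it integral. Writing X as A / B covers the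
    integral abscissas of P and R as well as that of P + R. *)
Lemma halving_E' (m : int) (S : ec_point (curve_E' m)) (X Y : rat) :
  ec_val (S + S) = Some (X, Y) -> forall A B : int, B%:~R * X = A%:~R -> exists u v : int,
  coprime `|u| `|v| /\
  B * ((u ^+ 2 - v ^+ 2) ^+ 2 + 8 * m ^+ 6 * u * v ^+ 3) =
  4 * A * (v * (u ^+ 3 + u * v ^+ 2 - m ^+ 6 * v ^+ 3)).
Proof.
move=> /ec_val_double[x]; have [u [v [_ nv cuv ->]]] := rat_coprimeP x.
rewrite /= => e A B hX; exists u, v; split=> //; apply: (@intr_inj rat).
rewrite !(rmorphD, rmorphB, rmorphM, rmorphXn) /= -hX.
have -> (C : rat) : 4 * (B%:~R * X) * C = B%:~R * (4 * X * C) by ring.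
congr (_ * _); transitivity (v%:~R ^+ 4 *
   (((u%:~R / v%:~R) ^+ 2 - 1) ^+ 2 - 8 * - m%:~R ^+ 6 * (u%:~R / v%:~R)) : rat).
  by field.
by rewrite e; field.
Qed.

(** * From indivisibility by 2 to a lower bound on the rank *)

Lemma finZmod_halving (T : finZmodType) : (forall t : T, t + t = 0 -> t = 0) ->
  forall t : T, exists s, s + s = t.
Proof.
move=> h t; have inj : injective (fun s : T => s + s).
  move=> a b /= e; apply/subr0_eq/h.
  by rewrite addrACA -opprD e subrr.
by have [g _ gK] := injF_bij inj; exists (g t).
Qed.

(** For r < 2 the quotient of Z^r by its doubles has at most two elements; two odd integers have an
    even sum. *)
Lemma rV_lt2_halving r (a b : 'rV[int]_r) : (r < 2)%N ->
  exists c, [\/ c + c = a, c + c = b | c + c = a + b].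
Proof.
case: r a b => [|[|//]] a b _; first by exists 0; constructor 1; rewrite [RHS]thinmx0 addr0.
have half (d : 'rV[int]_1) : ~~ oddz (d 0 0) -> exists c, c + c = d.
  rewrite oddz_dvd2 => /negPn/dvdzP[k hk]; exists (const_mx k).
  by apply/rowP => i; rewrite !mxE (ord1 i) hk; ring.
have [oa|/half[c <-]] := boolP (oddz (a 0 0)); last by exists c; constructor 1.
have [ob|/half[c <-]] := boolP (oddz (b 0 0)); last by exists c; constructor 2.
have [|c hc] := half (a + b); first by rewrite mxE oddzD oa ob.
by exists c; constructor 3.
Qed.

(** If r < 2, one of p, q, p + q has an even free part; its torsion part can be halved too, doubling
    being bijective on [T], so the element itself is a double. *)
Lemma has_rank_ge2 (G : zmodType) (r : nat) (p q : G) : has_rank G r ->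
  (forall s : G, s + s = 0 -> s = 0) ->
  (forall s : G, [/\ s + s != p, s + s != q & s + s != p + q]) ->
  (2 <= r)%N.
Proof.
move=> [T [f [g fK gK]]] tors nohalf; rewrite leqNgt; apply/negP => r2.
have f_inj := can_inj fK.
have halfT : forall t : T, exists s, s + s = t.
  apply: finZmod_halving => t t2.
  (* [g] is given only as an inverse map, so sums of its values are computed through the additive
     injection [f]. *)
  have e : g (0, t) = 0.
    apply/tors/f_inj; rewrite raddfD raddf0 /= gK.
    by congr (_, _); rewrite ?addr0.
  by have := gK (0, t); rewrite e raddf0 => -[].
have half x : (exists c, c + c = (f x).1) -> exists s, s + s = x.
  move=> [c hc]; have [t ht] := halfT (f x).2.
  exists (g (c, t)); apply: f_inj; rewrite raddfD /= gK.
  by rewrite [RHS]surjective_pairing -hc -ht.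
have [c hc] := rV_lt2_halving (f p).1 (f q).1 r2.
have [x [xpq]] : exists x, [\/ x = p, x = q | x = p + q] /\ c + c = (f x).1.
  case: hc => hc; [exists p | exists q | exists (p + q)]; split=> //.
  - by constructor 1. - by constructor 2. - by constructor 3.
  by rewrite hc raddfD.
move=> hx; have [|s hs] := half x; first by exists c.
have [/eqP n1 /eqP n2 /eqP n3] := nohalf s.
by case: xpq => e; rewrite e in hs.
Qed.

Theorem theorem1p3 (m : int) (m_gt1 : 1 < m) (m_not3 : ~~ (3 %| m)%Z)
    (m_2 : (2 %| m)%Z) (m_not4 : ~~ (4 %| m)%Z) (r : nat) :
  has_rank (ec_point (curve_E' m)) r -> (2 <= r)%N.
Proof.
have [n on mn] : exists2 n, oddz n & m = 2 * n.
  move/dvdzP: m_2 m_not4 => [n ->] n4; exists n; last by rewrite mulrC.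
  by rewrite oddz_dvd2; apply: contra n4 => /dvdzP[k ->]; rewrite -mulrA dvdz_mull.
have m0 : m%:~R != 0 :> rat by rewrite intr_eq0; lia.
(* P and R have distinct abscissas, so their sum is given by the chord. *)
have m4 : m%:~R ^+ 6 - m%:~R ^+ 2 != 0 :> rat.
  rewrite -!rmorphXn -rmorphB intr_eq0 subr_eq0 /=.
  by rewrite gt_eqF // ltr_eXn2l.
have hP : on_curve (curve_E' m) (Some (m%:~R ^+ 2, m%:~R)).
  by rewrite on_curve_E'; apply/eqP; ring.
have hR : on_curve (curve_E' m) (Some (m%:~R ^+ 6, m%:~R ^+ 9)).
  by rewrite on_curve_E'; apply/eqP; ring.
move=> hr; apply: (@has_rank_ge2 _ r (ECPoint hP) (ECPoint hR) hr).
  move=> S; apply: ec_double_eq0 => x /=; rewrite mul1r; exact: cubic_E'_neq0.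
move=> S; split; apply/eqP => /(congr1 (@ec_val _ _)).
- move=> /halving_E'/(_ (m ^+ 2) 1)[|u [v [cuv]]].
    by rewrite mul1r rmorphXn.
  by rewrite mul1r mn; apply: no_half_P.
- move=> /halving_E'/(_ (m ^+ 6) 1)[|u [v [cuv]]].
    by rewrite mul1r rmorphXn.
  by rewrite mul1r mn; apply: no_half_R.
rewrite [RHS]ec_val_add /= /ec_slope.
have -> : m%:~R ^+ 2 == m%:~R ^+ 6 :> rat = false.
  by apply/negbTE; rewrite eq_sym -subr_eq0.
(* The chord has slope (m^9 - m) / (m^6 - m^2) = (m^4 + 1) / m; its square minus m^2 + m^6 is (m^4 +
   1) / m^2. *)
move=> /halving_E'/(_ (m ^+ 4 + 1) (m ^+ 2))[|u [v [cuv]]].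
  by rewrite rmorphD !rmorphXn /=; field.
by rewrite mn; apply: no_half_PR.
Qed.
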